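(* For any positive integers $N,\eta,\alpha$ there exists a positive integer $N^*$ such that the following holds. Let $G$ be a graph that admits a tree-cut decomposition $(T,(X_t:t\in V(T)))$ of adhesion at most $\eta$ such that every bag contains at most $\alpha$ vertices. For every $t\in V(T)$, let $k_t$ be a positive integer with $k_t+|X_t|\ge 2$ such that the graph obtained from the torso at $t$ by deleting $X_t$ is $k_t$-colorable with clustering $N$. Then $G$ is $\max_{t\in V(T)}\{k_t+\min\{|X_t|,1\}\}$-colorable with clustering $N^*$.
   Context: Graphs are finite and may have loops and parallel edges. For positive integers $k,N$, $G$ is $k$-colorable with clustering $N$ if there is $c:V(G)\to\{1,\dots,k\}$ such that every connected component of each induced subgraph $G[c^{-1}(i)]$ has at most $N$ vertices. A tree-cut decomposition of $G$ is a pair $(T,(X_t:t\in V(T)))$ where $T$ is a tree and the $X_t$ (bags) are pairwise disjoint, possibly empty, subsets of $V(G)$ whose union is $V(G)$. For a subtree $S$ write $X_S=\bigcup_{t\in V(S)}X_t$. For an edge $t_1t_2$ of $T$, with $T_1,T_2$ the components of $T-t_1t_2$, the adhesion set of $t_1t_2$ is the set of edges of $G$ with one end in $X_{T_1}$ and the other in $X_{T_2}$; the adhesion of the decomposition is the maximum size of an adhesion set. The torso at $t$ is the graph obtained from $G$ by, for each edge $tt'$ of $T$, identifying $X_{T_{t,t'}}$ into a single vertex and deleting all loops incident with this new vertex, where $T_{t,t'}$ is the component of $T-t$ containing $t'$. *)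

(* Defs.v *)
From HB Require Import structures.
From mathcomp Require Import all_boot.

Set Implicit Arguments.
Unset Strict Implicit.
Unset Printing Implicit Defensive.

(* Finite undirected graphs with loops and parallel edges.  The order of the two
   ends of an edge carries no meaning: every notion below is symmetric in it. *)
Record mgraph := MGraph {
  vert :> finType;
  edge : finType;
  ends : edge -> vert * vert
}.

Definition joins (G : mgraph) (e : edge G) (x y : G) : bool :=
  (ends e == (x, y)) || (ends e == (y, x)).

Definition adj (G : mgraph) : rel G := [rel x y | [exists e, joins e x y]].
Arguments adj : clear implicits.

Definition component (G : mgraph) (x : G) : {set G} :=
  [set y | connect (adj G) x y].

Definition components (G : mgraph) : {set {set G}} :=
  [set component x | x : G].
Arguments components : clear implicits.

Section InducedSubgraph.
Variables (G : mgraph) (A : {set G}).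

Definition induced_edge : finType :=
  {e : edge G | ((ends e).1 \in A) && ((ends e).2 \in A)}.

Definition induced_ends (e : induced_edge) : {x : G | x \in A} * {x : G | x \in A} :=
  (exist (fun x : G => x \in A) _ (proj1 (elimT andP (valP e))),
   exist (fun x : G => x \in A) _ (proj2 (elimT andP (valP e)))).

Definition induced : mgraph := MGraph induced_ends.

End InducedSubgraph.

Definition delete_vertices (G : mgraph) (A : {set G}) : mgraph := induced (~: A).

Definition delete_edge (G : mgraph) (e : edge G) : mgraph :=
  MGraph (fun f : {f : edge G | f != e} => ends (val f)).

Definition clustered_colorable (G : mgraph) (k N : nat) : Prop :=
  exists c : G -> 'I_k, forall i : 'I_k,
    forall C, C \in components (induced [set v | c v == i]) -> #|C| <= N.

(* A cycle is listed as (v_1, e_1), ..., (v_n, e_n) with n >= 1, where e_i joins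
   v_i to v_{i+1} and e_n joins v_n to v_1; n = 1 is a loop and n = 2 a pair of
   parallel edges. *)
Definition is_cycle (G : mgraph) (s : seq (G * edge G)) : bool :=
  [&& s != [::], uniq [seq p.1 | p <- s], uniq [seq p.2 | p <- s]
    & cycle (fun p q : G * edge G => joins p.2 p.1 q.1) s].

Definition is_tree (T : mgraph) : Prop :=
  [/\ 0 < #|T|,
      forall x y : T, connect (adj T) x y
    & forall s : seq (T * edge T), ~~ is_cycle s].

(* The vertex set of the component of T - t containing t'. *)
Definition branch (T : mgraph) (t t' : T) : {set T} :=
  [set s | [exists C in components (delete_vertices [set t]),
             (t' \in val @: C) && (s \in val @: C)]].

Record tree_cut_decomposition (G : mgraph) := TreeCutDecomposition {
  tcd_tree :> mgraph;
  bag : tcd_tree -> {set G};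
  tcd_treeP : is_tree tcd_tree;
  bag_disjoint : forall t1 t2, t1 != t2 -> [disjoint bag t1 & bag t2];
  bag_cover : \bigcup_t bag t = [set: G]
}.

Lemma branch_exists (T : mgraph) (t s : T) :
  is_tree T -> s != t -> exists2 t', adj T t t' & s \in branch t t'.
Proof.
case=> _ conT _ nst.
have /connectP[p0 p0P sE] := conT t s.
rewrite {s}sE in nst *.
case/shortenP: p0P nst => -[|t' p] /=; first by rewrite eqxx.
move=> /andP[tt' pP] /andP[tNp _] _ _; exists t' => //.
have inP x : x != t -> x \in ~: [set t] by rewrite !inE.
have t'N : t' != t by move: tNp; rewrite inE negb_or eq_sym => /andP[].
have {}tNp : t \notin p by move: tNp; rewrite inE negb_or => /andP[].
pose u : delete_vertices [set t] := exist _ t' (inP _ t'N).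
rewrite inE; apply/existsP; exists (component u).
rewrite imset_f // (_ : t' \in _) /=; last first.
  by apply/imsetP; exists u; rewrite // inE connect0.
apply/imsetP.
suff [w uw wE] : exists2 w, connect (adj (delete_vertices [set t])) u w
                          & val w = last t' p by exists w; rewrite ?inE.
have : val u = t' by [].
move: u => u; clear t'N tt'; elim: p t' u pP tNp => [|y p IHp] x u /=.
  by move=> _ _ ux; exists u; rewrite ?connect0.
case/andP=> /existsP[e exy] yP; rewrite inE negb_or eq_sym => /andP[yNt tNp] ux.
pose v : delete_vertices [set t] := exist _ y (inP _ yNt).
have [//|//|//|w vw wE] := IHp y v.
exists w => //; apply: connect_trans vw; apply: connect1.
have eA : ((ends e).1 \in ~: [set t]) && ((ends e).2 \in ~: [set t]).
  have xA := valP u; have yA := valP v; rewrite /= ux in xA.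
  by case/orP: exy => /eqP-> /=; rewrite xA inP.
apply/existsP; exists (exist _ e eA).
case/orP: exy => /eqP eE; apply/orP; [left|right]; apply/eqP;
  by congr pair; apply: val_inj; rewrite /= eE ?ux.
Qed.

Section Decomposition.
Variables (G : mgraph) (D : tree_cut_decomposition G).

Definition bag_union (S : {set D}) : {set G} := \bigcup_(t in S) bag t.

Definition adhesion_set (e : edge D) : {set edge G} :=
  let X1 := bag_union (@component (delete_edge e) (ends e).1) in
  let X2 := bag_union (@component (delete_edge e) (ends e).2) in
  [set f : edge G | ((ends f).1 \in X1) && ((ends f).2 \in X2)
                 || ((ends f).1 \in X2) && ((ends f).2 \in X1)].

Definition adhesion : nat := \max_(e : edge D) #|adhesion_set e|.

Variable t : D.

(* The vertices of the torso at t: those of X_t, plus one new vertex for each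
   edge tt' of the tree, onto which the vertices of the bags beyond t' are
   identified. *)
Definition torso_vert : finType :=
  ({x : G | x \in bag t} + {t' : D | adj D t t'})%type.

Definition represents (x : torso_vert) (v : G) : bool :=
  match x with
  | inl u => val u == v
  | inr t' => v \in bag_union (branch t (val t'))
  end.

Lemma represents_exists (v : G) : exists x, represents x v.
Proof.
have: v \in [set: G] by [].
rewrite -(bag_cover D) => /bigcupP[s _ vs].
have [st|nst] := eqVneq s t.
  by rewrite st in vs; exists (inl (exist _ v vs)) => /=.
have [t' tt' sb] := branch_exists (tcd_treeP D) nst.
by exists (inr (exist _ t' tt')); apply/bigcupP; exists s.
Qed.

(* The identification map.  The representative is unique, as the bags are
   disjoint and distinct neighbours of t in a tree lie in distinct components of
   T - t. *)
Definition torso_proj (v : G) : torso_vert := xchoose (represents_exists v).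

Definition is_new (x : torso_vert) : bool := if x is inr _ then true else false.

Definition torso_edge : finType :=
  {e : edge G | ~~ ((torso_proj (ends e).1 == torso_proj (ends e).2)
                    && is_new (torso_proj (ends e).1))}.

Definition torso_ends (e : torso_edge) : torso_vert * torso_vert :=
  (torso_proj (ends (val e)).1, torso_proj (ends (val e)).2).

Definition torso : mgraph := MGraph torso_ends.

Definition torso_bag : {set torso} := [set x : torso_vert | ~~ is_new x].

End Decomposition.

(* Main.v *)
Require Import Defs.
From mathcomp Require Import all_boot zify.

(** Root the tree T.  Let R be a connected set of nodes such that at most 2 eta
    edges of G leave X_R, and precolour all ends in X_R of these edges with one
    colour i.  Let S be the closure under lowest common ancestors of the nodes
    whose bags meet the precoloured set, together with the top node of R, and
    colour X_S with i.  Every component ("piece") of R - S is attached to S by at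
    most two tree edges, so again at most 2 eta edges leave it, and it can be
    coloured recursively once one colour has been chosen for its boundary.  A
    bounded number of special pieces, namely those with a node of S below them
    and those touched by an edge crossing the tree edge above a node of S, get a
    fixed colour different from i.  Any other piece is a branch at some s in S
    and gets its colour from the torso at s, avoiding i if X_s is not empty.  No
    piece adjacent to X_S gets colour i, so the monochromatic components through
    X_S are bounded; and since each special piece has at most 2 eta neighbours,
    the pieces form monochromatic clusters of bounded size. *)

Set Implicit Arguments.
Unset Strict Implicit.
Unset Printing Implicit Defensive.

(** * Bounds on reachability classes *)

Lemma connect_sub_closed (T : finType) (e : rel T) (U : {set T}) x y :
  (forall a b, a \in U -> e a b -> b \in U) ->
  x \in U -> connect e x y -> y \in U.
Proof.
move=> clU + /connectP[p + ->].
by elim: p x => //= z p IHp x xU /andP[exz] /(IHp z (clU x z xU exz)).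
Qed.

Lemma card_connect_le (T : finType) (e : rel T) (U : {set T}) x :
  (forall a b, a \in U -> e a b -> b \in U) ->
  x \in U -> #|[set y | connect e x y]| <= #|U|.
Proof.
move=> clU xU; apply/subset_leq_card/subsetP => y; rewrite inE.
exact: connect_sub_closed.
Qed.

Lemma card_bigcup_le (I T : finType) (A : {set I}) (F : I -> {set T}) n :
  (forall i, i \in A -> #|F i| <= n) -> #|\bigcup_(i in A) F i| <= #|A| * n.
Proof.
move=> Fn; apply: leq_trans (_ : \sum_(i in A) #|F i| <= _); last first.
  by rewrite -sum_nat_const; apply: leq_sum.
elim/big_rec2: _ => [|i m B _ IH]; first by rewrite cards0.
by apply: leq_trans (leq_card_setU _ _) _; rewrite leq_add2l.
Qed.

(** A path ends in [Sp], or avoids it, or after its last visit there runs inside the [Sp]-avoiding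
    class of a neighbour. The summands count [Sp], the classes of its neighbours and the class of
    [x]. *)
Lemma card_connect_special (T : finType) (h : rel T) (Sp : {set T}) B d N x :
  #|Sp| <= B -> (forall p, p \in Sp -> #|[set q | h p q]| <= d) ->
  (forall q, #|[set y | connect [rel a b | [&& h a b, a \notin Sp & b \notin Sp]] q y]|
     <= N) ->
  #|[set y | connect h x y]| <= B + B * (d * N) + N.
Proof.
set h' := [rel a b | _] => SpB degSp hN.
pose F q := [set y | connect h' q y].
pose U := Sp :|: \bigcup_(p in Sp) \bigcup_(q in [set q | h p q]) F q :|: F x.
apply: (@leq_trans #|U|).
  apply: card_connect_le => [a b aU hab|]; last by rewrite !inE connect0 orbT.
  have [bSp|bSp] := boolP (b \in Sp); first by rewrite !in_setU bSp.
  have [aSp|aSp] := boolP (a \in Sp).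
    rewrite !in_setU; apply/orP; left; apply/orP; right.
    apply/bigcupP; exists a => //; apply/bigcupP; exists b; first by rewrite inE.
    by rewrite inE connect0.
  have h'ab : h' a b by rewrite /= hab aSp.
  have stepF q : a \in F q -> b \in F q.
    rewrite inE => qa; rewrite inE; exact: connect_trans qa (@connect1 _ h' _ _ h'ab).
  move: aU; rewrite !in_setU (negPf aSp) /= => /orP[/bigcupP[p pSp]|/stepF ->].
    case/bigcupP=> q hpq /stepF bq; apply/orP; left; apply/orP; right.
    by apply/bigcupP; exists p => //; apply/bigcupP; exists q.
  by rewrite orbT.
apply: leq_trans (leq_card_setU _ _) _; apply: leq_add; last exact: hN.
apply: leq_trans (leq_card_setU _ _) _; apply: leq_add => //.
apply: (@leq_trans (#|Sp| * (d * N))); last by rewrite leq_mul2r SpB orbT.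
apply: card_bigcup_le => p pSp.
apply: (@leq_trans (#|[set q | h p q]| * N)).
  by apply: card_bigcup_le => q _; apply: hN.
by rewrite leq_mul2r degSp ?orbT.
Qed.

Lemma adjC (G : mgraph) (a b : G) : adj G a b = adj G b a.
Proof. by rewrite /adj /=; apply: eq_existsb => e; rewrite /joins orbC. Qed.

(** * Rooted trees *)

Section RootedTree.
Variables (D : finType) (root : D) (par : D -> D) (dep : D -> nat).

Definition anc (y x : D) : bool := fconnect par x y.

Lemma ancP y x : reflect (exists n, y = iter n par x) (anc y x).
Proof.
apply: (iffP idP) => [xy|[n ->]]; last exact: fconnect_iter.
by exists (findex par x y); rewrite iter_findex.
Qed.

Lemma anc_refl x : anc x x. Proof. exact: connect0. Qed.

Lemma anc_trans y x z : anc x y -> anc y z -> anc x z.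
Proof. by move=> xy yz; apply: connect_trans yz xy. Qed.

Lemma anc_par x : anc (par x) x. Proof. exact: fconnect1. Qed.

Lemma anc_neq_par y x : anc y x -> y != x -> anc y (par x).
Proof.
case/ancP=> [[|n] ->]; first by rewrite eqxx.
by move=> _; rewrite iterSr; apply: fconnect_iter.
Qed.

Lemma anc_total a b x : anc a x -> anc b x -> anc a b \/ anc b a.
Proof.
case/ancP=> n ->; case/ancP=> m ->.
have [nm|/ltnW mn] := leqP n m.
  by right; rewrite -(subnK nm) iterD; apply: fconnect_iter.
by left; rewrite -(subnK mn) iterD; apply: fconnect_iter.
Qed.

Hypothesis par_root : par root = root.
Hypothesis dep_par : forall x, x != root -> dep (par x) < dep x.

Lemma anc_dep y x : anc y x -> y = x \/ dep y < dep x.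
Proof.
case/ancP=> n ->; elim: n => [|n IHn] /=; first by left.
have [E|nr] := eqVneq (iter n par x) root; first by rewrite E par_root -E.
by right; have := dep_par nr; case: IHn => [->//|]; lia.
Qed.

Lemma anc_dep_le y x : anc y x -> dep y <= dep x.
Proof. by case/anc_dep => [->|/ltnW]. Qed.

Lemma anc_anti x y : anc x y -> anc y x -> x = y.
Proof. by case/anc_dep => // xy /anc_dep_le; lia. Qed.

Lemma anc_par_ind (P : D -> Prop) :
  P root -> (forall x, x != root -> P (par x) -> P x) -> forall x, P x.
Proof.
move=> Pr IH x; have [n] := ubnP (dep x); elim: n x => // n IHn x xn.
have [->//|xr] := eqVneq x root.
by apply: IH (xr) _; apply: IHn; have := dep_par xr; lia.
Qed.

Lemma anc_root x : anc root x.
Proof.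
by elim/anc_par_ind: x => [|x _ IH]; [apply: anc_refl|apply: anc_trans IH (anc_par x)].
Qed.

Lemma anc_par_inj w w' z : w != root -> w' != root ->
  par w = par w' -> anc w z -> anc w' z -> w = w'.
Proof.
have aux a b : a != root -> par a = par b -> anc a b -> a = b.
  move=> ar pab ab; apply/eqP/negPn/negP => nab.
  have := anc_dep_le (anc_neq_par ab nab).
  by rewrite -pab; have := dep_par ar; lia.
move=> wr w'r pw wz w'z; case: (anc_total wz w'z) => H; first exact: aux.
by apply/esym; apply: aux.
Qed.

(** [root] is a common ancestor of any two nodes, and common ancestors form a chain, so there is
    exactly one deepest. *)
Definition lca x y := [arg max_(z > root | anc z x && anc z y) dep z].

Lemma lcaP x y : [/\ anc (lca x y) x, anc (lca x y) y
  & forall z, anc z x -> anc z y -> anc z (lca x y)].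
Proof.
rewrite /lca; case: arg_maxnP => [|m /andP[mx my] mmax]; first by rewrite !anc_root.
split=> // z zx zy; case: (anc_total zx mx) => // mz.
have := mmax z; rewrite zx zy => /(_ isT).
by case: (anc_dep mz) => [->|]; rewrite ?anc_refl //; lia.
Qed.

Lemma lca_eq x y m : anc m x -> anc m y ->
  (forall z, anc z x -> anc z y -> anc z m) -> lca x y = m.
Proof.
move=> mx my mmax; have [lx ly lmax] := lcaP x y.
by apply: anc_anti; [apply: mmax|apply: lmax].
Qed.

Definition lca_closure (Q : {set D}) := [set lca x y | x in Q, y in Q].

Lemma lca_closure_sub (Q : {set D}) : Q \subset lca_closure Q.
Proof.
apply/subsetP => x xQ; apply/imset2P; exists x x => //.
by apply/esym; apply: lca_eq => //; apply: anc_refl.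
Qed.

Lemma card_lca_closure (Q : {set D}) : #|lca_closure Q| <= #|Q| * #|Q|.
Proof.
rewrite /lca_closure curry_imset2X -cardsX; exact: leq_imset_card.
Qed.

(** For incomparable [p = lca x y] and [q = lca z t] one has [lca p q = lca x z]: a common ancestor
    of [x] and [z] below [p] would put [p] above [z], hence make it comparable with [q]. So one
    round of pairwise ancestors already closes [Q]. *)
Lemma lca_closed (Q : {set D}) p q :
  p \in lca_closure Q -> q \in lca_closure Q -> lca p q \in lca_closure Q.
Proof.
move=> pS qS; have [mp mq mmax] := lcaP p q.
have [pq|npq] := boolP (anc p q).
  by rewrite (lca_eq (anc_refl p) pq).
have [qp|nqp] := boolP (anc q p).
  by rewrite (lca_eq qp (anc_refl q)).
case/imset2P: pS => x y xQ yQ pE; case/imset2P: qS => z t zQ tQ qE.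
have [px _ _] := lcaP x y; rewrite -pE in px.
have [qz _ _] := lcaP z t; rewrite -qE in qz.
apply/imset2P; exists x z => //; apply/esym.
apply: lca_eq; [exact: anc_trans mp px|exact: anc_trans mq qz|].
move=> l lx lz; apply: mmax.
  case: (anc_total lx px) => // pl.
  by case: (anc_total (anc_trans pl lz) qz); rewrite ?(negPf npq) ?(negPf nqp).
case: (anc_total lz qz) => // ql.
by case: (anc_total (anc_trans ql lx) px); rewrite ?(negPf npq) ?(negPf nqp).
Qed.

(* R is connected in the tree, with topmost node u. *)
Definition region (u : D) (R : {set D}) :=
  u \in R /\ forall x, x \in R -> x != u -> x != root /\ par x \in R.

Lemma region_anc u R x : region u R -> x \in R -> anc u x.
Proof.
move=> [uR Rp]; elim/anc_par_ind: x => [rR|x _ IH xR].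
  have [->|ru] := eqVneq root u; first exact: anc_refl.
  by have [] := Rp _ rR ru; rewrite eqxx.
have [->|xu] := eqVneq x u; first exact: anc_refl.
by have [_ /IH upx] := Rp _ xR xu; apply: anc_trans upx (anc_par x).
Qed.

Lemma region_convex u R x z : region u R -> x \in R -> anc u z -> anc z x -> z \in R.
Proof.
move=> rR; elim/anc_par_ind: x => [rtR uz zr|x _ IH xR uz zx].
  by rewrite (anc_anti zr (anc_root z)).
have [->//|nzx] := eqVneq z x.
have [xu|xu] := eqVneq x u.
  by rewrite (anc_anti zx) // xu.
by have [_ pR] := (rR.2) _ xR xu; apply: IH => //; apply: anc_neq_par.
Qed.

(** * Pieces of a region after removing an lca-closed set *)

Section Split.
Variables (u : D) (R Q : {set D}).
Hypotheses (regR : region u R) (uQ : u \in Q) (QR : Q \subset R).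
Let S := lca_closure Q.

(** The components of [R] minus [S] are indexed by their topmost nodes, so that each is again a
    region with a known top. *)
Definition piece_tops : {set D} := [set w in R :\: S | par w \in S].
Definition piece (w : D) : {set D} :=
  [set x in R | anc w x && ~~ [exists z in S, anc w z && anc z x]].

Lemma lca_closure_region : S \subset R.
Proof.
apply/subsetP => z /imset2P[x y xQ yQ ->]; have [lx ly lmax] := lcaP x y.
have [xR yR] := (subsetP QR x xQ, subsetP QR y yQ).
by apply: (region_convex regR xR _ lx); apply: lmax; apply: (region_anc regR).
Qed.

Lemma top_in_closure : u \in S. Proof. exact: (subsetP (lca_closure_sub Q)). Qed.

Lemma piece_tops_neq_root w : w \in piece_tops -> w != root.
Proof.
rewrite !inE -/S => /andP[/andP[wS wR] _]; apply: (proj1 (regR.2 w wR _)).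
by apply: contraNneq wS => ->; apply: top_in_closure.
Qed.

Lemma piece_anc w x : x \in piece w -> anc w x.
Proof. by rewrite inE => /and3P[]. Qed.

Lemma piece_sub w : piece w \subset R.
Proof. by apply/subsetP => x; rewrite inE => /and3P[]. Qed.

Lemma piece_notin w x z : x \in piece w -> z \in S -> anc w z -> ~~ anc z x.
Proof.
rewrite inE => /and3P[_ _ /existsPn/(_ z)] + zS wz; by rewrite -/S zS wz.
Qed.

Lemma piece_disj w x : x \in piece w -> x \notin S.
Proof.
move=> xw; apply/negP => xS.
by have := piece_notin xw xS (piece_anc xw); rewrite anc_refl.
Qed.

Lemma piece_exists x : x \in R -> x \notin S -> exists2 w, w \in piece_tops & x \in piece w.
Proof.
elim/anc_par_ind: x => [rR|x _ IH xR] xS.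
  have [|] := (regR.2 _ rR); last by rewrite eqxx.
  by apply: contraNneq xS => ->; apply: top_in_closure.
have [|_ pR] := regR.2 _ xR; first by apply: contraNneq xS => ->; apply: top_in_closure.
have [pS|pS] := boolP (par x \in S).
  exists x; first by rewrite inE -/S in_setD xS xR pS.
  rewrite inE xR anc_refl; apply/existsPn => z; apply/negP => /and3P[zS xz zx].
  by rewrite (anc_anti xz zx) zS in xS.
have [w ww pw] := IH pR pS; exists w => //.
rewrite inE xR (anc_trans (piece_anc pw) (anc_par x)).
apply/existsPn => z; apply/negP => /and3P[zS wz zx].
have := piece_notin pw zS wz; rewrite anc_neq_par //.
by apply: contraNneq xS => <-.
Qed.

(** Two tops above [x] are comparable; if they differed, the parent of the lower one, a node of [S],
    would separate the upper one from [x]. *)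
Lemma piece_uniq w w' x : w \in piece_tops -> w' \in piece_tops ->
  x \in piece w -> x \in piece w' -> w = w'.
Proof.
have aux a b : b \in piece_tops -> x \in piece a -> x \in piece b -> anc a b -> a = b.
  rewrite [b \in _]inE => /andP[_ pbS] xa xb ab; apply/eqP/negPn/negP => nab.
  have := piece_notin xa pbS (anc_neq_par ab nab).
  by rewrite (anc_trans (anc_par b) (piece_anc xb)).
move=> wW w'W xw xw'.
case: (anc_total (piece_anc xw) (piece_anc xw')) => H; first exact: aux H.
by apply/esym; apply: aux H.
Qed.

Lemma piece_region w : w \in piece_tops -> region w (piece w).
Proof.
move=> wW; move: (wW); rewrite inE -/S in_setD => /andP[/andP[wS wR] pwS].
split=> [|x xw nxw].
  rewrite inE wR anc_refl; apply/existsPn => z; apply/negP => /and3P[zS wz zw].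
  by rewrite (anc_anti wz zw) zS in wS.
have xS := piece_disj xw; have xR := subsetP (piece_sub w) _ xw.
have [|xr pR] := regR.2 _ xR; first by apply: contraNneq xS => ->; apply: top_in_closure.
split=> //; rewrite inE pR anc_neq_par ?piece_anc 1?eq_sym //.
apply/existsPn => z; apply/negP => /and3P[zS wz zx].
by have := piece_notin xw zS wz; rewrite (anc_trans zx (anc_par x)).
Qed.

(** [u] lies in [S], hence in no piece; the induction on the size of a region rests on this. *)
Lemma piece_proper w : #|piece w| < #|R|.
Proof.
apply/proper_card/properP; split; first exact: piece_sub.
exists u; first exact: (subsetP lca_closure_region _ top_in_closure).
by apply/negP => /piece_disj; rewrite top_in_closure.
Qed.

(* Closure under lca makes a highest element of S below w unique; hence at most
   two tree edges, above w and above b, separate a piece from the rest of R. *)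
Lemma piece_bottom w :
  (forall z, z \in S -> ~~ anc w z) \/
  exists b, [/\ b \in S, anc w b & forall z, z \in S -> anc w z -> anc b z].
Proof.
have [/existsP[z0 z0P]|H] := boolP [exists z in S, anc w z]; last first.
  by left=> z zS; move/existsPn: H => /(_ z); rewrite zS.
right; case: (@arg_minnP _ z0 (fun z => (z \in S) && anc w z) dep z0P) => b /andP[bS wb] bmin.
exists b; split=> // z zS wz; have [lb lz lmax] := lcaP b z.
have := bmin (lca b z); rewrite lca_closed // lmax // => /(_ isT).
by case: (anc_dep lb) => [<-//|lt]; rewrite leqNgt lt.
Qed.

End Split.

(** * Colouring regions *)

Section Coloring.
Variables (G : mgraph) (beta : G -> D) (C : finType) (eta alpha N : nat).

Definition cut (U : {set G}) : {set edge G} :=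
  [set e | ((ends e).1 \in U) != ((ends e).2 \in U)].

Definition boundary (U : {set G}) : {set G} :=
  [set if (ends e).1 \in U then (ends e).1 else (ends e).2 | e in cut U].

Definition over (R : {set D}) : {set G} := [set v | beta v \in R].
Definition below (b : D) : {set G} := [set v | anc b (beta v)].

(** Adjacency of equally coloured new vertices in the torso at [t], restricted to the children of
    [t] and transported to tree nodes. *)
Definition child_rel (t : D) (c : D -> C) : rel D :=
  [rel a b | [&& a != root, b != root, par a == t, par b == t, c a == c b
    & [exists x in below a, exists y in below b, adj G x y]]].

Definition mono (f : G -> C) (R : {set D}) : rel G :=
  [rel a b | [&& beta a \in R, beta b \in R, adj G a b & f a == f b]].

Lemma in_over (R : {set D}) v : (v \in over R) = (beta v \in R).
Proof. by rewrite inE. Qed.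

Lemma adj_cut (a b : G) (U : {set G}) : adj G a b -> (a \in U) != (b \in U) ->
  exists2 e, e \in cut U & joins e a b.
Proof.
case/existsP=> e eab nab; exists e => //; rewrite inE.
by case/orP: eab => /eqP ->; rewrite //= eq_sym.
Qed.

Lemma adj_boundary (a b : G) (U : {set G}) : adj G a b -> a \in U -> b \notin U -> a \in boundary U.
Proof.
move=> ab aU bU; have [|e eU eab] := @adj_cut a b U ab; first by rewrite aU (negPf bU).
apply/imsetP; exists e => //.
by case/orP: eab => /eqP ->; rewrite /= ?aU // (negPf bU).
Qed.

Lemma adj_ends (e : edge G) : adj G (ends e).1 (ends e).2.
Proof. by apply/existsP; exists e; rewrite /joins -surjective_pairing eqxx. Qed.

Hypothesis card_cut_below : forall b, #|cut (below b)| <= eta.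
Hypothesis card_bag : forall t, #|[set v | beta v == t]| <= alpha.
(** The colouring may depend on [i]: at a node with nonempty bag the palette has a colour more than
    the torso needs, so any given colour can be spared. *)
Hypothesis child_coloring : forall t i, exists c : D -> C,
  ((exists v, beta v = t) -> forall x, c x != i) /\
  forall x, #|[set y | connect (child_rel t c) x y]| <= N.
Hypothesis other_color : forall i : C, exists j, j != i.

(** The marked nodes are at most [2 * eta] boundary nodes and the top; closing under lca squares
    their number. Each resulting node of [S], called a hub, carries at most [alpha] vertices.
    Special pieces are counted by pairs of hubs and by ends of crossing edges. The final successor
    makes the bound positive. *)
Definition hub_bound := (2 * eta).+1 * (2 * eta).+1.
Definition core_bound := hub_bound * alpha.
Definition special_bound := hub_bound * hub_bound + hub_bound * (eta + eta).
Definition cluster_bound := special_bound + special_bound * (2 * eta * N) + N.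
Definition clustering_bound := (cluster_bound * core_bound + core_bound).+1.

(* All vertices with a neighbour outside the region lie in Z and get colour i,
   and the monochromatic components meeting Z stay inside Z. *)
Definition region_coloring (R : {set D}) (i : C) (f : G -> C) (Z : {set G}) :=
  [/\ boundary (over R) \subset Z, Z \subset over R & #|Z| <= core_bound] /\
  [/\ forall v, v \in Z -> f v = i,
      forall v w, v \in Z -> adj G v w -> beta w \in R -> f w = i -> w \in Z
    & forall x, beta x \in R -> #|[set y | connect (mono f R) x y]| <= clustering_bound].

(** * The recursive step from pieces to a region *)

Section Step.
Variables (u : D) (R : {set D}).
Hypotheses (regR : region u R) (card_cutR : #|cut (over R)| <= 2 * eta).

Let Q := u |: beta @: boundary (over R).
Let S := lca_closure Q.
Let W := piece_tops R Q.
Let P := piece R Q.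

Lemma top_in_marks : u \in Q. Proof. exact: setU11. Qed.

Lemma marks_sub : Q \subset R.
Proof.
rewrite subUset sub1set regR.1; apply/subsetP => x /imsetP[v /imsetP[e eR ->] ->].
move: eR; rewrite !inE; case: ifP => [//|_].
by case: (beta (ends e).2 \in R).
Qed.

Lemma card_hubs : #|S| <= hub_bound.
Proof.
apply: leq_trans (card_lca_closure Q) _.
have QB : #|Q| <= (2 * eta).+1.
  rewrite /Q cardsU1; have : #|beta @: boundary (over R)| <= 2 * eta.
    apply: leq_trans (leq_imset_card _ _) _.
    by apply: leq_trans (leq_imset_card _ _) card_cutR.
  by case: (_ \notin _); lia.
exact: leq_mul.
Qed.

Lemma card_core : #|over S| <= core_bound.
Proof.
have -> : over S = \bigcup_(s in S) [set v | beta v == s].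
  apply/setP => v; rewrite inE; apply/idP/bigcupP => [vS|[s sS]].
    by exists (beta v); rewrite // inE.
  by rewrite inE => /eqP ->.
apply: leq_trans (_ : #|S| * alpha <= _); first by apply: card_bigcup_le.
by rewrite leq_mul2r card_hubs orbT.
Qed.

Lemma hubs_sub : S \subset R. Proof. exact: lca_closure_region regR marks_sub. Qed.

Lemma boundary_core : boundary (over R) \subset over S.
Proof.
apply/subsetP => v vB; rewrite inE; apply: (subsetP (lca_closure_sub Q)).
by rewrite !inE; apply/orP; right; apply: imset_f.
Qed.

(** A neighbour outside [R] would make [a] a boundary vertex, and these all lie over [S], which
    pieces avoid. *)
Lemma piece_exit w a b : beta a \in P w -> adj G a b -> beta b \in R.
Proof.
move=> aw ab; apply/negPn/negP => bR; have := piece_disj aw.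
have aR := subsetP (piece_sub R Q w) _ aw.
have /(subsetP boundary_core) : a \in boundary (over R).
  by apply: adj_boundary ab _ _; rewrite inE.
by rewrite inE => ->.
Qed.

(** An edge leaving the piece stays in [R], so it crosses the tree edge above [w] or the one above
    the highest hub [b] below [w]. Each cut has at most [eta] edges, which restores the invariant
    [2 * eta]. *)
Lemma card_cut_piece w : w \in W -> #|cut (over (P w))| <= 2 * eta.
Proof.
move=> wW.
have [b bE] : exists b, forall x y, adj G x y -> beta x \in P w -> beta y \notin P w ->
    (x \in below w) != (y \in below w) \/ (x \in below b) != (y \in below b).
  have wP x : x \in P w -> anc w x by apply: piece_anc.
  have exitP x y : adj G x y -> beta x \in P w -> beta y \notin P w -> anc w (beta y) ->
      exists2 z, z \in S & anc w z && anc z (beta y).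
    move=> xy xw yw wy; move: yw; rewrite !inE (piece_exit xw xy) wy /=.
    by rewrite negbK => /existsP[z /andP[]]; exists z.
  have [noS|[b [bS wb bmin]]] := piece_bottom Q w.
    exists w => x y xy xw yw; left; rewrite !inE wP //.
    apply/negP => /eqP/esym /(exitP _ _ xy xw yw)[z zS /andP[wz _]].
    by have := noS z zS; rewrite wz.
  exists b => x y xy xw yw; rewrite !inE wP //.
  have [wy|] := boolP (anc w (beta y)); last by left.
  right; have [z zS /andP[wz zy]] := exitP _ _ xy xw yw wy.
  by rewrite (negPf (piece_notin xw bS wb)) (anc_trans (bmin z zS wz) zy).
apply: (@leq_trans #|cut (below w) :|: cut (below b)|); last first.
  apply: leq_trans (leq_card_setU _ _) _.
  by have := card_cut_below w; have := card_cut_below b; lia.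
apply/subset_leq_card/subsetP => e.
rewrite in_setU ![e \in cut _]inE ![_ \in over _]inE => ew; apply/orP.
have [xw|xw] := boolP (beta (ends e).1 \in P w).
  by apply: (bE _ _ (adj_ends e) xw); move: ew; rewrite xw; case: (_ \in _).
have yw : beta (ends e).2 \in P w by move: ew; rewrite (negPf xw); case: (_ \in _).
rewrite eq_sym [((ends e).1 \in below b) == _]eq_sym.
by apply: bE yw xw; rewrite adjC adj_ends.
Qed.

Definition top_of (x : D) : D := odflt root [pick w in W | x \in P w].

Lemma top_ofE w x : w \in W -> x \in P w -> top_of x = w.
Proof.
move=> wW xw; rewrite /top_of; case: pickP => [w' /andP[w'W xw']|/(_ w)] /=.
  exact: (piece_uniq w'W wW xw' xw).
by rewrite wW xw.
Qed.

Lemma top_ofP x : x \in R -> x \notin S -> top_of x \in W /\ x \in P (top_of x).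
Proof.
move=> xR xS; have [w wW xw] := piece_exists regR top_in_marks xR xS.
by rewrite (top_ofE wW xw).
Qed.

(* A piece that is not special is a whole branch of R at its parent s, and all
   edges leaving it go to X_s or to other such branches at s. *)
Definition special : {set D} :=
  [set w in W | [exists z in S, anc w z] ||
    [exists s in S, exists e in cut (below s),
       (beta (ends e).1 \in P w) || (beta (ends e).2 \in P w)]].

(** A special piece above a hub [z] is recovered from its parent and [z], by [anc_par_inj]; the
    others contain an end of one of the at most [eta] edges counted for each hub. *)
Lemma card_special : #|special| <= special_bound.
Proof.
pose g (s : D * D) := odflt root [pick w in W | (par w == s.1) && anc w s.2].
pose F s := [set top_of (beta (ends e).1) | e in cut (below s)] :|:
            [set top_of (beta (ends e).2) | e in cut (below s)].
apply: (@leq_trans #|g @: setX S S :|: \bigcup_(s in S) F s|).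
  apply/subset_leq_card/subsetP => w; rewrite inE => /andP[wW /orP[]].
    case/existsP=> z /andP[zS wz]; rewrite in_setU; apply/orP; left.
    have pS : par w \in S by move: wW; rewrite inE => /andP[].
    apply/imsetP; exists (par w, z); first by rewrite in_setX pS.
    rewrite /g; case: pickP => [w' /and3P[w'W /eqP pw w'z]|/(_ w)] /=.
      apply: anc_par_inj (piece_tops_neq_root regR top_in_marks wW) _ _ wz w'z => //.
      exact: (piece_tops_neq_root regR top_in_marks w'W).
    by rewrite wW eqxx wz.
  case/existsP=> s /andP[sS /existsP[e /andP[es ew]]]; rewrite in_setU; apply/orP; right.
  apply/bigcupP; exists s => //; rewrite in_setU; apply/orP.
  by case/orP: ew => /(top_ofE wW) <-; [left|right]; apply/imsetP; exists e.
apply: leq_trans (leq_card_setU _ _) _; apply: leq_add.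
  apply: leq_trans (leq_imset_card _ _) _.
  by rewrite cardsX leq_mul ?card_hubs.
apply: (@leq_trans (#|S| * (eta + eta))); last by rewrite leq_mul2r card_hubs orbT.
apply: card_bigcup_le => s _; apply: leq_trans (leq_card_setU _ _) _.
by apply: leq_add; apply: leq_trans (leq_imset_card _ _) (card_cut_below s).
Qed.

Lemma nonspecial_adj w a b s : w \in W -> w \notin special -> beta a \in P w ->
  adj G a b -> s \in S -> anc s (beta a) = anc s (beta b).
Proof.
move=> wW; rewrite inE wW negb_or => /andP[_ /existsPn noS] aw ab sS.
apply/eqP/negPn/negP => nab.
have [|e es eab] := @adj_cut a b (below s) ab; first by rewrite !inE.
have /negP[] := noS s; rewrite sS; apply/existsP; exists e; rewrite es.
by case/orP: eab => /eqP ->; rewrite /= aw ?orbT.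
Qed.

(** A hub above [x] is comparable with [w]; it is neither below [w] nor equal to it, hence it is
    above [par w]. *)
Lemma nonspecial_anc w x s : w \in W -> w \notin special -> x \in P w -> s \in S ->
  anc s x = anc s (par w).
Proof.
move=> wW; rewrite inE wW negb_or => /andP[/existsPn noS _] xw sS.
have wx := piece_anc xw.
apply/idP/idP => [sx|sp]; last first.
  exact: anc_trans sp (anc_trans (anc_par w) wx).
case: (anc_total sx wx) => [sw|ws]; last by have := noS s; rewrite sS ws.
apply: anc_neq_par sw _; apply: contraTneq wW => <-.
by rewrite inE -/S in_setD sS.
Qed.

Lemma par_top_hub w : w \in W -> par w \in S.
Proof. by rewrite inE => /andP[]. Qed.

(** Both ends of the edge have the same hubs above them, and these are the hubs above [par w] and
    those above [par w']. The parents are hubs themselves, so each is an ancestor of the other. *)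
Lemma nonspecial_par w w' a b : w \in W -> w' \in W ->
  w \notin special -> w' \notin special ->
  beta a \in P w -> beta b \in P w' -> adj G a b -> par w = par w'.
Proof.
move=> wW w'W nw nw' aw bw' ab; apply: anc_anti.
  rewrite -(nonspecial_anc w'W nw' bw' (par_top_hub wW)).
  rewrite -(nonspecial_adj wW nw aw ab (par_top_hub wW)).
  exact: anc_trans (anc_par w) (piece_anc aw).
rewrite -(nonspecial_anc wW nw aw (par_top_hub w'W)).
rewrite (nonspecial_adj wW nw aw ab (par_top_hub w'W)).
exact: anc_trans (anc_par w') (piece_anc bw').
Qed.

Lemma nonspecial_hub w a b : w \in W -> w \notin special -> beta a \in P w ->
  adj G a b -> beta b \in S -> beta b = par w.
Proof.
move=> wW nw aw ab bS; apply: anc_anti.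
  by rewrite -(nonspecial_anc wW nw aw bS) (nonspecial_adj wW nw aw ab bS) anc_refl.
rewrite -(nonspecial_adj wW nw aw ab (par_top_hub wW)).
exact: anc_trans (anc_par w) (piece_anc aw).
Qed.

Definition piece_rel (j : D -> C) : rel D :=
  [rel w w' | [&& w \in W, w' \in W, w != w', j w == j w'
    & [exists x in over (P w), exists y in over (P w'), adj G x y]]].

Lemma card_piece_rel j w : #|[set q | piece_rel j w q]| <= 2 * eta.
Proof.
have [wW|wW] := boolP (w \in W); last first.
  rewrite (_ : [set _ | _] = set0) ?cards0 //.
  apply/setP => q; rewrite in_set in_set0; apply/negP => /and5P[wW'].
  by case/negP: wW.
apply: leq_trans (card_cut_piece wW).
apply: leq_trans (leq_imset_card (fun e =>
  top_of (beta (if (ends e).1 \in over (P w) then (ends e).2 else (ends e).1))) _).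
apply/subset_leq_card/subsetP => q; rewrite inE => /and5P[_ qW nwq _].
case/existsP=> x /andP[xw /existsP[y /andP[yq xy]]].
have yw : y \notin over (P w).
  apply/negP => yw; rewrite !in_over in yq yw.
  by rewrite (piece_uniq wW qW yw yq) eqxx in nwq.
have [|e ew exy] := @adj_cut x y (over (P w)) xy; first by rewrite xw (negPf yw).
apply/imsetP; exists e => //; rewrite -(top_ofE qW (x := beta y)); last by rewrite in_over in yq.
by case/orP: exy => /eqP -> /=; rewrite ?xw ?(negPf yw).
Qed.

(** [card_connect_special] absorbs the special pieces, using their bounded degree; clusters of
    nonspecial pieces stay at one parent by [nonspecial_par], so the torso colouring there bounds
    them by [N]. *)
Lemma piece_colors i : exists j : D -> C,
  (forall w a b, w \in W -> beta a \in P w -> adj G a b -> beta b \in S -> j w != i) /\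
  forall w, #|[set y | connect (piece_rel j) w y]| <= cluster_bound.
Proof.
have [c cP] := fin_all_exists (fun t => child_coloring t i).
have [j0 j0i] := other_color i.
exists (fun w => if w \in special then j0 else c (par w) w); split.
  move=> w a b wW aw ab bS; case: ifP => // /negbT nw.
  (* [b] shows that the bag at [par w] is nonempty, so the colours there avoid [i]. *)
  by apply: (cP (par w)).1; exists b; apply: nonspecial_hub ab bS.
move=> w; apply: card_connect_special card_special _ _ => [p _|q].
  exact: card_piece_rel.
apply: leq_trans ((cP (par q)).2 q).
apply/subset_leq_card/subsetP => y; rewrite !inE.
set h := (h in connect h) => /connectP[p pP ->].
(* The equality of parents is carried along the walk, because each parent has its own colouring
   [c (par w)]. *)
suff : par (last q p) = par q /\ connect (child_rel (par q) (c (par q))) q (last q p).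
  by case.
elim/last_ind: p pP => [|p z IHp]; first by rewrite connect0.
rewrite rcons_path last_rcons => /andP[/IHp[pE qp]].
set l := last q p in pE qp *.
rewrite /h /= => /and3P[/and5P[lW zW lz /eqP jE /existsP[x /andP[xl]]]].
case/existsP=> y' /andP[yz xy] nl nz; rewrite !in_over in xl yz.
have pz := nonspecial_par lW zW nl nz xl yz xy.
rewrite -pz pE; split=> //; apply: connect_trans qp (connect1 _).
rewrite /child_rel /= !(piece_tops_neq_root regR top_in_marks) // -pz pE eqxx /=.
move: jE; rewrite (negPf nl) (negPf nz) -pz pE => ->; rewrite eqxx /=.
apply/existsP; exists x; rewrite inE (piece_anc xl).
by apply/existsP; exists y'; rewrite inE (piece_anc yz).
Qed.

Lemma region_step i :
  (forall w, w \in W -> forall j, exists f Z, region_coloring (P w) j f Z) ->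
  exists f Z, region_coloring R i f Z.
Proof.
move=> IH; have [j [jS jcl]] := piece_colors i.
have /fin_all_exists[fz fzP] : forall w, exists fz : (G -> C) * {set G},
    w \in W -> region_coloring (P w) (j w) fz.1 fz.2.
  move=> w; have [wW|_] := boolP (w \in W); last by exists (fun=> i, set0).
  by have [f [Z fZ]] := IH w wW (j w); exists (f, Z).
pose F w := (fz w).1; pose Z w := (fz w).2.
have {fzP} FP w : w \in W -> region_coloring (P w) (j w) (F w) (Z w) := fzP w.
pose f x := if beta x \in S then i else F (top_of (beta x)) x.
have fS x : beta x \in S -> f x = i by rewrite /f => ->.
have fP w x : w \in W -> beta x \in P w -> f x = F w x.
  by move=> wW xw; rewrite /f (negPf (piece_disj xw)) (top_ofE wW xw).
have bdZ w a b : w \in W -> beta a \in P w -> adj G a b -> beta b \notin P w -> a \in Z w.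
  move=> wW aw ab bw; have [[/subsetP bZ _ _] _] := FP w wW; apply: bZ.
  by apply: adj_boundary ab _ _; rewrite inE.
have ZP w a : w \in W -> a \in Z w -> beta a \in P w.
  by move=> wW aZ; have [[_ /subsetP/(_ a aZ)]] := FP w wW; rewrite inE.
have fZ w a : w \in W -> a \in Z w -> f a = j w.
  move=> wW aZ; rewrite (fP _ _ wW (ZP _ _ wW aZ)).
  by have [_ [Fj _ _]] := FP w wW; apply: Fj.
(* A vertex of a piece next to the core lies in [Z] and so has the colour of its piece, which is not
   [i]. *)
have hub_adj v w : beta v \in S -> adj G v w -> beta w \in R -> f w = i -> beta w \in S.
  move=> vS vw wR fw; apply/negPn/negP => wS; have [tW wt] := top_ofP wR wS.
  have wv : adj G w v by rewrite adjC.
  have wZ : w \in Z (top_of (beta w)).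
    by apply: bdZ wv _ => //; apply: contraL vS => /piece_disj.
  by have := jS _ _ _ tW wt wv vS; rewrite -(fZ _ _ tW wZ) fw eqxx.
exists f, (over S); split; first split.
- exact: boundary_core.
- by apply/subsetP => x; rewrite !in_over; apply: subsetP hubs_sub _.
- exact: card_core.
split=> [v|v w|x xR]; first by rewrite in_over; apply: fS.
  by rewrite !in_over; apply: hub_adj.
have [xS|xS] := boolP (beta x \in S).
  apply: (@leq_trans #|over S|); last first.
    by have := card_core; rewrite /clustering_bound; lia.
  apply: card_connect_le; last by rewrite inE.
  move=> a b; rewrite !in_over => aS /and4P[_ bR ab /eqP fab].
  by apply: hub_adj ab bR _ => //; rewrite -fab fS.
have [tW xt] := top_ofP xR xS; set w := top_of (beta x) in tW xt.
(* Outside [Z w] the component never leaves the piece, since only vertices of [Z w] have neighbours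
   elsewhere; nor does it enter [Z w], which contains all neighbours of its own colour in the piece.
   The bound is that of the piece. *)
have [xZ|xZ] := boolP (x \in Z w); last first.
  have [_ [Fj Fadj Fcl]] := FP w tW.
  apply: leq_trans (Fcl x xt).
  pose U := [set y | connect (mono (F w) (P w)) x y & (y \notin Z w) && (beta y \in P w)].
  apply: (@leq_trans #|U|); last first.
    by apply/subset_leq_card/subsetP => y; rewrite !inE => /and3P[].
  apply: card_connect_le; last by rewrite inE connect0 xZ xt.
  move=> a b; rewrite inE => /and3P[xa aZ aw] /and4P[_ bR ab /eqP fab].
  have bw : beta b \in P w by apply: contraNT aZ; apply: bdZ ab.
  have Fab : F w a = F w b by rewrite -!fP.
  rewrite inE bw andbT; apply/andP; split.
    by apply: connect_trans xa (connect1 _); rewrite /mono /= aw bw ab Fab eqxx.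
  apply: contra aZ => bZ; apply: (Fadj b a) => //; first by rewrite adjC.
  by rewrite Fab Fj.
(* From [Z w] the component cannot enter the core and moves only among the sets [Z w'] of the pieces
   clustered with [w]. *)
pose Cl := [set w' | connect (piece_rel j) w w'].
have ClW w' : w' \in Cl -> w' \in W.
  rewrite inE; apply: connect_sub_closed tW => a b _; by case/and5P.
pose U := \bigcup_(w' in Cl) Z w'.
apply: (@leq_trans #|U|); last first.
  apply: (@leq_trans (#|Cl| * core_bound)).
    by apply: card_bigcup_le => w' /ClW w'W; have [[]] := FP w' w'W.
  have : #|Cl| * core_bound <= cluster_bound * core_bound by rewrite leq_mul2r jcl orbT.
  by rewrite /clustering_bound; lia.
apply: card_connect_le; last first.
  by apply/bigcupP; exists w; rewrite // inE connect0.
move=> a b /bigcupP[w1 w1C aZ] /and4P[_ bR ab /eqP fab].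
have w1W := ClW _ w1C; have aw1 := ZP _ _ w1W aZ; have fa := fZ _ _ w1W aZ.
have bS : beta b \notin S.
  by apply/negP => bS; have := jS _ _ _ w1W aw1 ab bS; rewrite -fa fab fS ?eqxx.
have [] := top_ofP bR bS; set w2 := top_of (beta b) => w2W bw2.
have [E|nw] := eqVneq w1 w2.
  apply/bigcupP; exists w1 => //; have [_ [_ Fadj _]] := FP w1 w1W.
  apply: Fadj aZ ab _ _; rewrite ?E // -E -?fP ?E //.
  by rewrite -E -fab.
have bZ : b \in Z w2.
  apply: (@bdZ w2 b a) => //; first by rewrite adjC.
  by apply: contra nw => aw2; rewrite (piece_uniq w1W w2W aw1 aw2).
apply/bigcupP; exists w2 => //; rewrite inE in w1C; rewrite inE.
apply: connect_trans w1C (connect1 _); rewrite /piece_rel /= w1W w2W nw -fa fab (fZ w2) ?eqxx //=.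
apply/existsP; exists a; rewrite in_over aw1; apply/existsP; exists b.
by rewrite in_over bw2.
Qed.

End Step.

Lemma region_colorable u R i : region u R -> #|cut (over R)| <= 2 * eta ->
  exists f Z, region_coloring R i f Z.
Proof.
have [n] := ubnP #|R|; elim: n u R i => // n IHn u R i Rn regR cutR.
apply: (region_step regR cutR) => w wW j; apply: IHn (piece_region regR (top_in_marks _ _) wW) _.
  exact: leq_trans (piece_proper regR (top_in_marks _ _) (marks_sub regR) w) Rn.
exact: card_cut_piece.
Qed.

Lemma tree_coloring (i : C) : exists f : G -> C, forall x,
  #|[set y | connect [rel a b | adj G a b && (f a == f b)] x y]| <= clustering_bound.
Proof.
have [||f [Z [_ [_ _ fN]]]] := @region_colorable root setT i.
- split=> [|x _ xr]; first by rewrite inE.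
  by rewrite xr inE.
- rewrite (_ : cut _ = set0) ?cards0 //.
  by apply/setP => e; rewrite !inE eqxx.
exists f => x; apply: leq_trans (fN x _); last by rewrite inE.
apply/subset_leq_card/subsetP => y; rewrite !inE.
by apply: connect_sub => a b ab; apply: connect1; rewrite /mono /= !inE.
Qed.

End Coloring.
End RootedTree.

(** * Tree-cut decompositions *)

Lemma adj_induced (G : mgraph) (A : {set G}) (x y : induced A) :
  adj (induced A) x y = adj G (val x) (val y).
Proof.
apply/existsP/existsP => [[e exy]|[e exy]].
  exists (val e); move: exy; rewrite /joins.
  by case/orP=> /eqP[<- <-] /=; rewrite -surjective_pairing eqxx ?orbT.
have eA : ((ends e).1 \in A) && ((ends e).2 \in A).
  by case/orP: exy => /eqP -> /=; rewrite (valP x) (valP y).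
exists (exist _ e eA); case/orP: exy => /eqP eE; apply/orP; [left|right];
  by apply/eqP; congr pair; apply: val_inj; rewrite /= eE.
Qed.

Lemma clustered_colorable_connect (G : mgraph) k N (f : G -> 'I_k) :
  (forall x, #|[set y | connect [rel a b | adj G a b && (f a == f b)] x y]| <= N) ->
  clustered_colorable G k N.
Proof.
move=> fN; exists f => i Cp /imsetP[x _ ->]; apply: leq_trans (fN (val x)).
rewrite -(card_imset _ val_inj); apply/subset_leq_card/subsetP => _ /imsetP[y + ->].
rewrite !inE => /connectP[p + ->].
elim: p x => [|z p IHp] x /=; first by rewrite connect0.
case/andP=> xz /IHp; apply: connect_trans; apply: connect1.
move: xz; rewrite adj_induced /= => ->.
have := valP x; have := valP z; rewrite !inE /= => /eqP -> /eqP ->.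
by rewrite eqxx.
Qed.

(** * Cycles in trees and rooting *)

Lemma next_next_neq (T : eqType) (L : seq T) x :
  uniq L -> 2 < size L -> x \in L -> next L (next L x) != x.
Proof.
move=> uL sL xL; have [i s' E] := rot_to xL.
rewrite -2!(next_rot i uL) E.
have := rot_uniq i L; rewrite uL E; have := size_rot i L; rewrite E.
case: s' {E} => [|a [|b s]] /= sE; [by rewrite -sE in sL|by rewrite -sE in sL|].
rewrite !inE !negb_or => /and4P[/and3P[xa xb _] _ _ _].
by rewrite !eqxx [a == x]eq_sym (negPf xa) eq_sym.
Qed.

(** Choosing an edge for each step turns the node sequence into a cycle of the multigraph. Two steps
    sharing an edge would traverse it in opposite directions, which [next_next_neq] excludes beyond
    length two. *)
Lemma uniq_cycle_lt3 (T : mgraph) (L : seq T) :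
  is_tree T -> uniq L -> cycle (adj T) L -> size L <= 2.
Proof.
case=> _ _ acy uL cL; rewrite leqNgt; apply/negP => sL.
have nextP x : x \in L -> adj T x (next L x) by apply: next_cycle.
have [e0 _] : exists e : edge T, true.
  by case: L sL {uL cL} nextP => // x L _ /(_ x (mem_head _ _))/existsP[e _]; exists e.
pose ed x y := odflt e0 [pick e | joins e x y].
have edP x y : adj T x y -> joins (ed x y) x y.
  by case/existsP=> e exy; rewrite /ed; case: pickP => //= /(_ e); rewrite exy.
pose s := [seq (x, ed x (next L x)) | x <- L].
suff : is_cycle s by rewrite (negPf (acy s)).
apply/and4P; split.
- by case: L sL @s {uL cL nextP}.
- by rewrite -map_comp map_id.
- rewrite -map_comp map_inj_in_uniq // => x y xL yL /= E.
  have := edP _ _ (nextP x xL); have := edP _ _ (nextP y yL); rewrite E /joins.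
  have xx := next_next_neq uL sL xL.
  case/orP=> /eqP -> /orP[] /eqP[yE nE] //.
  + by rewrite -yE nE eqxx in xx.
  + by rewrite -nE yE eqxx in xx.
rewrite cycle_map; have := cycle_next uL; apply: sub_in_cycle (allss L) => x y xL yL /=.
by move=> /eqP <-; apply: edP; apply: nextP.
Qed.

Definition avoid (T : mgraph) (t : T) : rel T :=
  [rel a b | [&& adj T a b, a != t & b != t]].

(** A simple path from [t1] to a different [t2] missing [t] would close up through [t] to a cycle of
    length at least three. *)
Lemma tree_neighbors_separated (T : mgraph) (t t1 t2 : T) : is_tree T ->
  adj T t t1 -> adj T t t2 -> connect (avoid t) t1 t2 -> t1 = t2.
Proof.
move=> treeT tt1 tt2 /connectP[p0 p0P t2E]; apply/eqP/negPn/negP.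
rewrite {}t2E in tt2 *; case/shortenP: p0P tt2 => p pP pu _ tt2 n12.
have tp : all (predC1 t) (t1 :: p).
  case: p pP n12 {pu tt2} => [|y p]; first by rewrite eqxx.
  move=> pP _; rewrite /= (_ : t1 != t); last by case/andP: pP => /and3P[].
  elim: p t1 y pP {tt1} => [|z p IHp] x y /=; first by rewrite !andbT => /and3P[].
  by case/andP=> /and3P[_ _ ->] /IHp.
case: p n12 pP pu tp tt2 => [|y p]; first by rewrite eqxx.
move=> _ pP pu tp tt2.
have uL : uniq [:: t, t1, y & p].
  by rewrite cons_uniq pu andbT; apply/negP => /(allP tp) /=; rewrite eqxx.
have cL : cycle (adj T) [:: t, t1, y & p].
  rewrite (cycle_path t) /= adjC tt2 tt1 /=.
  by apply: (sub_path _ pP) => a b /and3P[].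
by have := uniq_cycle_lt3 treeT uL cL.
Qed.

(** Depth is the distance from an arbitrary root, and the parent of [x] is the last but one node of
    a shortest walk to [x]. *)
Lemma tree_rooted (T : mgraph) : is_tree T ->
  exists (root : T) (par : T -> T) (dep : T -> nat),
  [/\ par root = root, forall x, x != root -> dep (par x) < dep x
    & forall x, x != root -> adj T x (par x)].
Proof.
case=> /card_gt0P[root _] conT _.
pose walk x n := [exists p : n.-tuple T, path (adj T) root p && (last root p == x)].
have walkP x : exists n, walk x n.
  have /connectP[p pP ->] := conT root x; exists (size p).
  by apply/existsP; exists (in_tuple p); rewrite pP eqxx.
pose dep x := ex_minn (walkP x).
have /fin_all_exists[par parP] : forall x, exists y,
    if x == root then y = root else adj T x y /\ dep y < dep x.
  move=> x; have [_|xr] := eqVneq x root; first by exists root.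
  rewrite {2}/dep; case: ex_minnP => n /existsP[p /andP[pP /eqP pE]] _.
  case: p pP pE => p /= /eqP <-.
  case/lastP: p => [|p y]; first by move=> _ /= xE; rewrite xE eqxx in xr.
  rewrite rcons_path last_rcons size_rcons => /andP[pP py] <-.
  exists (last root p); split; first by rewrite adjC.
  rewrite /dep; case: ex_minnP => m _; rewrite ltnS; apply.
  by apply/existsP; exists (in_tuple p); rewrite pP eqxx.
exists root, par, dep; split=> [|x xr|x xr].
- by have := parP root; rewrite eqxx.
- by have := parP x; rewrite (negPf xr) => -[].
- by have := parP x; rewrite (negPf xr) => -[].
Qed.

(** * Adhesion and torsos in terms of the rooted tree *)

Section Translation.
Variables (G : mgraph) (D : tree_cut_decomposition G) (beta : G -> D).
Variables (root : D) (par : D -> D) (dep : D -> nat).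
Hypothesis par_root : par root = root.
Hypothesis dep_par : forall x, x != root -> dep (par x) < dep x.
Hypothesis adj_par : forall x, x != root -> adj D x (par x).
Hypothesis bagE : forall v t, (v \in bag t) = (beta v == t).

Lemma anc_connect (e : rel D) b x :
  (forall y, anc par y x -> anc par b y -> y != b -> e y (par y)) ->
  anc par b x -> connect e x b.
Proof.
elim/(anc_par_ind dep_par): x => [|x _ IH] eP bx.
  by rewrite (anc_anti par_root dep_par bx (anc_root dep_par b)) connect0.
have [->|xb] := eqVneq x b; first exact: connect0.
have bp : anc par b (par x) by apply: anc_neq_par bx _; rewrite eq_sym.
apply: connect_trans (connect1 (eP x (anc_refl _ x) bx xb)) (IH _ bp) => y yx.
by apply: eP; apply: anc_trans yx (anc_par par x).
Qed.

Lemma anc_neq_root b y : anc par b y -> y != b -> y != root.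
Proof.
move=> b_y; apply: contraNneq => yr; rewrite yr in b_y *.
by apply/eqP; apply: (anc_anti par_root dep_par (anc_root dep_par b) b_y).
Qed.

Lemma par_not_anc b : b != root -> ~~ anc par b (par b).
Proof.
move=> br; apply/negP => /(anc_dep_le par_root dep_par).
by rewrite leqNgt dep_par.
Qed.

(** For [b] other than the root, the cut lies in the adhesion set of an edge between [b] and its
    parent: once that edge is deleted, nodes below [b] still climb to [b], and all others, [par b]
    included, climb to the root. *)
Lemma card_cut_below_adhesion b : #|cut (below par beta b)| <= adhesion D.
Proof.
have [->|br] := eqVneq b root.
  rewrite (_ : cut _ = set0) ?cards0 //.
  by apply/setP => e; rewrite !inE !(anc_root dep_par) eqxx.
have /existsP[e0 e0P] := adj_par br.
apply: leq_trans (leq_bigmax e0); apply/subset_leq_card/subsetP => f.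
pose T' := delete_edge e0.
(* If [e0] led from [y] to its parent, then [y = b], or [y = par b] with parent [b], against
   depth. *)
have stepP y : y != root -> y != b -> adj T' y (par y).
  move=> yr yb; have /existsP[e eP] := adj_par yr.
  have ne : e != e0.
    apply: contraNneq yb => E; rewrite E in eP; move: e0P eP; rewrite /joins.
    case/orP=> /eqP -> /orP[] /eqP[E1 E2]; rewrite ?E1 ?E2 //.
    - by have := par_not_anc br; rewrite E2 E1 (anc_par par).
    - by have := par_not_anc br; rewrite E1 E2 (anc_par par).
  by apply/existsP; exists (exist _ e ne).
have symT' : connect_sym (adj T') by apply: sym_connect_sym => x y; apply: adjC.
have inside x : anc par b x -> x \in @component T' b.
  move=> bx; rewrite inE symT'; apply: (@anc_connect (adj T')) bx => y _ b_y yb.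
  exact: stepP (anc_neq_root b_y yb) yb.
have to_root x : ~~ anc par b x -> connect (adj T') x root.
  move=> bx; apply: (@anc_connect (adj T')) (anc_root dep_par x) => y yx _ yr.
  by apply: stepP => //; apply: contraNneq bx => <-.
have outside x : ~~ anc par b x -> x \in @component T' (par b).
  move=> bx; rewrite inE; apply: connect_trans (to_root _ (par_not_anc br)) _.
  by rewrite symT' to_root.
have inU v (S : {set D}) : beta v \in S -> v \in bag_union S.
  by move=> vS; apply/bigcupP; exists (beta v); rewrite ?bagE.
rewrite !inE /adhesion_set => fP.
case: (boolP (anc par b (beta (ends f).1))) fP => f1 /=.
  move=> f2; have {}f2 : ~~ anc par b (beta (ends f).2) by move: f2; case: anc.
  by case/orP: e0P => /eqP -> /=; apply/orP; [left|right]; rewrite !inU ?inside ?outside.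
move=> f2; have {}f2 : anc par b (beta (ends f).2) by move: f2; case: anc.
by case/orP: e0P => /eqP -> /=; apply/orP; [right|left]; rewrite !inU ?inside ?outside.
Qed.

Lemma branch_connect (t t' s : D) : s \in branch t t' -> connect (avoid t) t' s.
Proof.
rewrite inE => /existsP[Cp /and3P[/imsetP[x _ ->]]].
have conP (z : delete_vertices [set t]) :
    z \in component x -> connect (avoid t) (val x) (val z).
  rewrite inE => /connectP[p + ->]; elim: p x => [|y p IHp] x /=; first by rewrite connect0.
  case/andP=> xy /IHp; apply: connect_trans; apply: connect1.
  move: xy; rewrite adj_induced /avoid /= => ->.
  by have := valP x; have := valP y; rewrite !inE => -> ->.
have symA : connect_sym (avoid t).
  by apply: sym_connect_sym => a b; rewrite /avoid /= adjC; case: adj; rewrite //= andbC.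
move=> /imsetP[z /conP xz ->] /imsetP[z' /conP xz' ->].
by apply: connect_trans xz'; rewrite symA.
Qed.

Section Torso.
Variable t : D.

Lemma adj_child a : a != root -> par a == t -> adj D t a.
Proof. by move=> ar /eqP <-; rewrite adjC adj_par. Qed.

(** [torso_proj] is a choice, so all other representatives of [v] must be excluded: vertices of the
    bag at [t], as [v] lies strictly below [t], and other neighbours of [t], as [t] separates them
    from [y]. *)
Lemma torso_proj_child (y : {t' : D | adj D t t'}) v :
  val y != root -> par (val y) = t -> v \in below par beta (val y) ->
  torso_proj t v = inr y.
Proof.
move=> yr pt; rewrite inE => yv.
have nt x : anc par (val y) x -> x != t.
  by move=> yx; apply: contraTneq yx => ->; have := par_not_anc yr; rewrite pt.
have := xchooseP (represents_exists t v); rewrite -/(torso_proj t v).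
case: (torso_proj t v) => [x|t'] /=.
  move=> /eqP vE; have := valP x; rewrite /= vE bagE => /eqP bt.
  by have := nt _ yv; rewrite bt eqxx.
case/bigcupP=> s sb; rewrite bagE => /eqP vs; rewrite -vs in sb.
congr inr; apply: val_inj.
apply: tree_neighbors_separated (tcd_treeP D) (valP t') (valP y) _.
apply: connect_trans (branch_connect sb) _.
apply: anc_connect yv => z _ yz nz.
have zr := anc_neq_root yz nz.
rewrite /avoid /= adj_par // nt //= nt //.
by apply: anc_neq_par yz _; rewrite eq_sym.
Qed.

Lemma torso_vert_new (y : {t' : D | adj D t t'}) :
  (inr y : torso t) \in ~: torso_bag t.
Proof. by rewrite !inE. Qed.

Definition new_vert (y : {t' : D | adj D t t'}) : delete_vertices (torso_bag t) :=
  exist _ (inr y : torso t) (torso_vert_new y).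

Lemma adj_new_vert (y z : {t' : D | adj D t t'}) a b :
  val y != root -> par (val y) = t -> val z != root -> par (val z) = t ->
  a \in below par beta (val y) -> b \in below par beta (val z) -> adj G a b ->
  y != z -> adj _ (new_vert y) (new_vert z).
Proof.
move=> yr py zr pz ay bz /existsP[e eab] yz; rewrite adj_induced /=.
have pa := torso_proj_child yr py ay; have pb := torso_proj_child zr pz bz.
have nyz : inr y != inr z :> torso_vert t by apply: contra yz => /eqP[->].
have eP : ~~ ((torso_proj t (ends e).1 == torso_proj t (ends e).2)
              && is_new (torso_proj t (ends e).1)).
  case/orP: eab => /eqP -> /=; rewrite pa pb negb_and ?nyz //.
  by rewrite eq_sym nyz.
apply/existsP; exists (exist _ e eP : torso_edge t).
by case/orP: eab => /eqP eE; rewrite /joins /= /torso_ends /= eE /= pa pb eqxx ?orbT.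
Qed.

Lemma torso_child_coloring k N : 0 < k -> 0 < N ->
  clustered_colorable (delete_vertices (torso_bag t)) k N ->
  exists c : D -> 'I_k, forall x,
    #|[set y | connect (child_rel root par beta t c) x y]| <= N.
Proof.
move=> k0 N0 [c0 c0P].
pose c x : 'I_k := if insub x is Some y then c0 (new_vert y) else Ordinal k0.
have cE y : c (val y) = c0 (new_vert y) by rewrite /c valK.
exists c => x.
(* A node that is not a child of [t] has no [child_rel] successor; its class is a singleton, bounded
   by [N0]. *)
have [/andP[xr /eqP xt]|nx] := boolP ((x != root) && (par x == t)); last first.
  apply: leq_trans N0; rewrite -(cards1 x); apply: card_connect_le; last by rewrite inE.
  move=> a b; rewrite !inE => /eqP -> /and5P[xr _ xt _ _].
  by rewrite xr xt in nx.
have tx : adj D t x by apply: adj_child; rewrite // xt.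
pose yx : {t' : D | adj D t t'} := exist _ x tx.
pose H := induced [set v | c0 v == c x].
have xP : new_vert yx \in [set v | c0 v == c x] by rewrite inE -cE.
pose hx : H := exist _ (new_vert yx) xP.
(* The value [t] is a mere default: [H] has no vertex from the bag at [t]. *)
pose g (z : H) : D := match val (val z) with inr y => val y | inl _ => t end.
apply: leq_trans (c0P (c x) (component hx) (imset_f _ _)) => //.
apply: leq_trans (leq_imset_card g _).
apply: card_connect_le; last first.
  by apply/imsetP; exists hx; rewrite // inE connect0.
move=> a b /imsetP[z zC aE] ab.
have [->|nab] := eqVneq b a; first by rewrite aE imset_f.
case/and5P: ab => ar br /eqP at_ /eqP bt_ /andP[/eqP cab /existsP[v /andP[va]]].
case/existsP=> w /andP[wb vw].
have tb : adj D t b by apply: adj_child; rewrite // bt_.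
pose yb : {t' : D | adj D t t'} := exist _ b tb.
have [ya yE] : exists ya, val (val z) = inr ya.
  case E: (val (val z)) => [q|ya]; last by exists ya.
  by have := valP (val z); rewrite E !inE.
have ya_a : val ya = a by rewrite aE /g yE.
have zE : val z = new_vert ya by apply: val_inj.
have bP : new_vert yb \in [set v | c0 v == c x].
  by rewrite inE -cE /= -cab -ya_a cE -zE; have := valP z; rewrite inE.
apply/imsetP; exists (exist _ (new_vert yb) bP : H) => //.
rewrite inE in zC; rewrite inE; apply: connect_trans zC (connect1 _).
rewrite adj_induced /= zE; apply: (@adj_new_vert _ _ v w); rewrite ?ya_a //.
by apply: contra nab => /eqP E; rewrite -ya_a E.
Qed.

End Torso.
End Translation.

Theorem theorem1p3 (N eta alpha : nat)
    (hN : 0 < N) (heta : 0 < eta) (halpha : 0 < alpha) :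
  exists Nstar : nat, 0 < Nstar /\
    forall (G : mgraph) (D : tree_cut_decomposition G) (k : D -> nat),
      adhesion D <= eta ->
      (forall t : D, #|bag t| <= alpha) ->
      (forall t : D,
         [/\ 0 < k t,
             2 <= k t + #|bag t|
           & clustered_colorable (delete_vertices (torso_bag t)) (k t) N]) ->
      clustered_colorable G (\max_(t : D) (k t + minn #|bag t| 1)) Nstar.
Proof.
exists (clustering_bound eta alpha N); split=> // G D k adhD bagD kD.
set K := \max_(t : D) _.
have /fin_all_exists[beta betaP] : forall v : G, exists t : D, v \in bag t.
  move=> v; have : v \in [set: G] by [].
  by rewrite -(bag_cover D) => /bigcupP[t _ vt]; exists t.
have bagE v t : (v \in bag t) = (beta v == t).
  apply/idP/eqP => [vt|<-//]; apply/eqP/negPn/negP => /(bag_disjoint (t := D)).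
  by move/pred0P/(_ v); rewrite /= betaP vt.
have [root [par [dep [par_root dep_par adj_par]]]] := tree_rooted (tcd_treeP D).
have kK t : k t + minn #|bag t| 1 <= K by apply: (leq_bigmax t).
(* An empty bag forces [k root] to be at least 2; otherwise the minimum contributes 1. *)
have K2 : 1 < K.
  by have [k0 k2 _] := kD root; apply: leq_trans (kK root); case: #|bag root| k2; lia.
have K1 : 0 < K.-1 by lia.
suff [f fP] : exists f : G -> 'I_K, forall x,
    #|[set y | connect [rel a b | adj G a b && (f a == f b)] x y]|
      <= clustering_bound eta alpha N by apply: clustered_colorable_connect fP.
apply: (tree_coloring par_root dep_par (beta := beta)).
- by move=> b; apply: leq_trans (card_cut_below_adhesion par_root dep_par adj_par bagE b) adhD.
- move=> t; rewrite (_ : [set v | beta v == t] = bag t) //.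
  by apply/setP => v; rewrite inE bagE.
- move=> t i; have [k0 _ tcol] := kD t.
  have [c cP] := torso_child_coloring par_root dep_par adj_par bagE k0 hN tcol.
  (* [h] is the inclusion of colours if the bag is empty, and otherwise the inclusion followed by
     [lift i], which skips [i]; the summand [minn #|bag t| 1] makes room for this. *)
  have [h [hi hinj]] : exists h : 'I_(k t) -> 'I_K,
      ((exists v, beta v = t) -> forall x, h x != i) /\ injective h.
    have kt := kK t; have [b0|b0] := posnP #|bag t|.
      have le_k : k t <= K by move: kt; lia.
      exists (widen_ord le_k); split=> [[v vt]|x y [] /val_inj //].
      by have := card0_eq b0 v; rewrite bagE vt eqxx.
    have le_k : k t <= K.-1 by move: kt; lia.
    exists (fun x => lift i (widen_ord le_k x)); split=> [_ x|x y /lift_inj[]/val_inj//].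
    by rewrite eq_sym neq_lift.
  exists (h \o c); split=> [tv x|x]; first exact: hi.
  apply: leq_trans (cP x); apply/subset_leq_card/subsetP => y; rewrite !inE.
  apply: connect_sub => a b ab; apply: connect1; move: ab.
  by rewrite /child_rel /= (inj_eq hinj).
- by move=> i; exists (lift i (Ordinal K1)); rewrite eq_sym neq_lift.
exact: Ordinal (ltnW K2).
Qed.
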